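(* (Fixed source case.) Let $D$ be a deck of $n\ge1$ cards (repeated values allowed), let $\mathcal O(D)$ be its set of reorderings and $N=\#\mathcal O(D)$. Then, as $a\to\infty$ through positive integers, the variation distance from uniform of the deck obtained by $a$-shuffling $D$ satisfies $$\frac12\sum_{D'\in\mathcal O(D)}\left|\mathbb{P}_a(D\to D')-\frac1N\right| = \kappa_1(D)\,a^{-1}+O(a^{-2}),\qquad \kappa_1(D)=\frac12\sum_{D'\in\mathcal O(D)}|c_1(D,D')|.$$
   Context: A deck of $n$ cards is a function $D$ from $\{1,\dots,n\}$ to a finite totally ordered set of values (the order is arbitrary). A permutation $\pi\in S_n$ acts on decks by moving the card in position $i$ to position $\pi(i)$: $(\pi D)(\pi(i))=D(i)$. $\mathcal O(D)=\{\pi D:\pi\in S_n\}$. $n_v$ is the number of cards of value $v$ in $D$. For a positive integer $a$, the $a$-shuffle distribution on $S_n$ is $\mathbb{P}_a(\pi)=\frac1{a^n}\binom{a+n-\operatorname{des}(\pi)-1}{n}$, where $\operatorname{des}(\pi)=\#\{1\le i\le n-1:\pi(i)>\pi(i+1)\}$, and $\mathbb{P}_a(D\to D')=\sum_{\pi\in S_n:\ \pi D=D'}\mathbb{P}_a(\pi)$. A $u$-$v$ digraph in $D$ is an index $i$ with $D(i)=u$, $D(i+1)=v$. A $u$-$v$ pair in $D$ is a pair $(i,j)$ with $i<j$, $D(i)=u$, $D(j)=v$. Define $W(D,u,v)=\#\{u\text{-}v\text{ digraphs in }D\}-\#\{v\text{-}u\text{ digraphs in }D\}$, $Z(D,u,v)=\#\{u\text{-}v\text{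 pairs in }D\}-\#\{v\text{-}u\text{ pairs in }D\}$, and for $D'\in\mathcal O(D)$ $$c_1(D,D')=\frac{n}{2N}\sum_{u<v}\frac{W(D,u,v)Z(D',u,v)}{n_un_v},$$ the sum being over pairs of values occurring in $D$. *)

(* Defs.v *)
From mathcomp Require Import all_boot all_order all_algebra all_fingroup.
From mathcomp Require Import all_classical all_reals all_analysis.

Set Implicit Arguments.
Unset Strict Implicit.
Unset Printing Implicit Defensive.

Import Order.TTheory GRing.Theory Num.Theory.
Import numFieldNormedType.Exports.

Local Open Scope ring_scope.

(* Positions 1, ..., n are represented by 0, ..., n-1, i.e. by 'I_n. *)
Definition deck (n : nat) (V : finType) : Type := {ffun 'I_n -> V}.

Definition deck_act (n : nat) (V : finType) (s : 'S_n) (D : deck n V) :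
  {ffun 'I_n -> V} := [ffun j => D ((s^-1)%g j)].

Lemma deck_actE (n : nat) (V : finType) (s : 'S_n) (D : deck n V) (i : 'I_n) :
  deck_act s D (s i) = D i.
Proof. by rewrite ffunE permK. Qed.

Definition reorderings (n : nat) (V : finType) (D : deck n V) :
  {set {ffun 'I_n -> V}} := [set deck_act s D | s : 'S_n].

Definition ncards (n : nat) (V : finType) (D : deck n V) (v : V) : nat :=
  #|[set i : 'I_n | D i == v]|.

(* In [des] and [ndigraphs], [j] is the position i+1; its existence encodes the
   bound i <= n-1 (in the numbering from 1). *)
Definition des (n : nat) (s : 'S_n) : nat :=
  #|[set i : 'I_n | [exists j : 'I_n, (j == i.+1 :> nat) && (s j < s i)%N]]|.

(* For a >= 1 the natural-number subtractions do not truncate, because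
   des s <= n - 1 when n >= 1. *)
Definition shuffle_prob (R : realType) (n : nat) (a : nat) (s : 'S_n) : R :=
  (a%:R ^+ n)^-1 * 'C(a + n - des s - 1, n)%:R.

Definition trans_prob (R : realType) (n : nat) (V : finType) (a : nat)
    (D D' : deck n V) : R :=
  \sum_(s : 'S_n | deck_act s D == D') shuffle_prob R a s.

Definition ndigraphs (n : nat) (V : finType) (D : deck n V) (u v : V) : nat :=
  #|[set i : 'I_n | [exists j : 'I_n,
      [&& j == i.+1 :> nat, D i == u & D j == v]]]|.

Definition npairs (n : nat) (V : finType) (D : deck n V) (u v : V) : nat :=
  #|[set p : 'I_n * 'I_n | [&& (p.1 < p.2)%N, D p.1 == u & D p.2 == v]]|.

Definition W (n : nat) (V : finType) (D : deck n V) (u v : V) : int :=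
  (ndigraphs D u v)%:Z - (ndigraphs D v u)%:Z.

Definition Z (n : nat) (V : finType) (D : deck n V) (u v : V) : int :=
  (npairs D u v)%:Z - (npairs D v u)%:Z.

(* [codom D] is used as a predicate on V: each value occurring in D is counted
   once, whatever its multiplicity in the deck. *)
Definition c1 (R : realType) (n : nat) (d : Order.disp_t) (V : finOrderType d)
    (D D' : deck n V) : R :=
  n%:R / (2 * #|reorderings D|%:R) *
  \sum_(u in codom D) \sum_(v in codom D | (u < v)%O)
    ((W D u v)%:~R * (Z D' u v)%:~R) / ((ncards D u)%:R * (ncards D v)%:R).

Definition kappa1 (R : realType) (n : nat) (d : Order.disp_t)
    (V : finOrderType d) (D : deck n V) : R :=
  2^-1 * \sum_(D' in reorderings D) `|c1 R D D'|.

Definition dist_unif (R : realType) (n : nat) (V : finType) (a : nat)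
    (D : deck n V) : R :=
  2^-1 * \sum_(D' in reorderings D)
    `|trans_prob R a D D' - #|reorderings D|%:R^-1|.

(* Main.v *)
(* Since n! 'C(a+n-1-des s, n) is a product of n factors a + (n-1-des s-k),
   n! P_a(s) = 1 + n ((n-1)/2 - des s) / a + O(a^-2), and n-1 - 2 des s is the
   sum over adjacent positions i, i+1 of the sign of s(i+1) - s(i).  Over all s
   carrying D to D', the pair (s i, s(i+1)) is equidistributed among the pairs of
   positions of D' showing the values u = D i and v = D(i+1), so that the sign
   averages to Z(D',u,v) / (n_u n_v) (to 0 if u = v); grouping the i by (u, v)
   produces W(D,u,v) and the coefficient c_1. The reverse triangle inequality
   passes from the transition probabilities to the distance. *)
Require Import Defs.
From mathcomp Require Import all_boot all_order all_algebra all_fingroup.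
From mathcomp Require Import all_classical all_reals all_analysis.
From mathcomp Require Import ring lra zify.

Set Implicit Arguments.
Unset Strict Implicit.
Unset Printing Implicit Defensive.

Import Order.TTheory GRing.Theory Num.Theory.
Import numFieldNormedType.Exports.
Local Open Scope ring_scope.

(** * First-order expansion of a single shuffle probability *)

(** For m < n both sides are 0, the product through its factor m - m. This later covers the small a
    for which the binomial coefficient vanishes. *)
Lemma natr_ffact (R : pzRingType) (m n : nat) :
  (m ^_ n)%:R = \prod_(k < n) (m%:R - k%:R) :> R.
Proof.
elim: n => [|n IHn]; first by rewrite ffactn0 big_ord0.
rewrite big_ord_recr /= -IHn ffactnSr natrM.
have [le_nm|lt_mn] := leqP n m; first by rewrite natrB.
by rewrite (ffact_small lt_mn) !mul0r.
Qed.

(** [C] depends only on [M] and [n], so one constant serves all permutations and all a. *)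
Lemma prod1D_expand (R : realFieldType) (M : R) (n : nat) : 0 <= M ->
  exists C : R, 0 <= C /\
    forall (x : nat -> R) (t : R), (forall k, (k < n)%N -> `|x k| <= M) ->
      0 <= t <= 1 ->
      `|\prod_(k < n) (1 + x k * t) - (1 + (\sum_(k < n) x k) * t)|
        <= C * t ^+ 2.
Proof.
move=> M0; elim: n => [|n [C [C0 IHn]]].
  exists 0; split=> // x t _ _.
  by rewrite !big_ord0 mul0r addr0 subrr normr0 mul0r.
(* The old error is multiplied by at most 1 + M; the new cross term S x_n t^2 is at most (n M) M
   t^2. *)
exists (C * (1 + M) + n%:R * M * M); split.
  by rewrite addr_ge0 ?mulr_ge0 ?addr_ge0.
move=> x t xM /andP[t0 t1]; rewrite !big_ord_recr /=.
set P := \prod_(i < n) _; set S := \sum_(i < n) _.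
have PS : `|P - (1 + S * t)| <= C * t ^+ 2.
  apply: IHn; last by rewrite t0.
  by move=> k kn; apply: xM; apply: ltnW.
have xnM : `|x n| <= M by apply: xM.
have SM : `|S| <= n%:R * M.
  apply: le_trans (ler_norm_sum _ _ _) _.
  rewrite -[n in n%:R]card_ord -sum1_card natr_sum mulr_suml.
  apply: ler_sum => i _; rewrite mul1r; apply: xM.
  exact: ltn_trans (ltn_ord i) _.
have -> : P * (1 + x n * t) - (1 + (S + x n) * t)
    = (P - (1 + S * t)) * (1 + x n * t) + S * x n * t ^+ 2 by ring.
apply: le_trans (ler_normD _ _) _; rewrite [leRHS]mulrDl; apply: lerD; last first.
  rewrite [leLHS]normrM (ger0_norm (exprn_ge0 2 t0)).
  by rewrite normrM ler_wpM2r ?exprn_ge0 // ler_pM.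
rewrite normrM -mulrA (mulrC (1 + M)) mulrA; apply: ler_pM => //.
apply: le_trans (ler_normD _ _) _; rewrite normr1 lerD2l normrM.
by rewrite -[leRHS]mulr1 ler_pM // ger0_norm.
Qed.

Lemma sum_ord_natr (R : numFieldType) (n : nat) :
  \sum_(k < n) k%:R = n%:R * (n%:R - 1) / 2 :> R.
Proof.
elim: n => [|n IHn]; first by rewrite big_ord0 !mul0r.
rewrite big_ord_recr /= IHn -natr1; by field.
Qed.

Lemma des_leq (n : nat) (s : 'S_n) : (des s <= n)%N.
Proof. by rewrite -[leqRHS]card_ord; apply: max_card. Qed.

Lemma shuffle_prob_expand (R : realType) (n : nat) : (1 <= n)%N ->
  exists C : R, forall (s : 'S_n) (a : nat), (0 < a)%N ->
    `|shuffle_prob R a s - n`!%:R^-1 *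
        (1 + n%:R * ((n%:R - 1) / 2 - (des s)%:R) / a%:R)| <= C * a%:R ^- 2.
Proof.
(* 2n is a crude bound for |n - 1 - des s - k| with k < n. *)
move=> n1; have [C [C0 HC]] := @prod1D_expand R (2 * n%:R) n (mulr_ge0 (ler0n _ 2) (ler0n _ n)).
exists (n`!%:R^-1 * C) => s a a0.
pose x k : R := n%:R - 1 - (des s)%:R - k%:R.
have a_neq0 : a%:R != 0 :> R by rewrite pnatr_eq0 -lt0n.
have f_neq0 : n`!%:R != 0 :> R by rewrite pnatr_eq0 -lt0n fact_gt0.
have dn := des_leq s.
have -> : shuffle_prob R a s = n`!%:R^-1 * \prod_(k < n) (1 + x k * a%:R^-1).
  rewrite /shuffle_prob; apply: (mulfI f_neq0); rewrite (mulVKf f_neq0).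
  rewrite mulrCA -natrM mulnC bin_ffact natr_ffact -exprVn -[n in _ ^+ n]card_ord.
  rewrite -prodr_const -big_split /=; apply: eq_bigr => k _.
  (* The subtractions do not truncate, because a > 0 and des s <= n. *)
  rewrite natrB; last by lia.
  rewrite natrB; last by lia.
  by rewrite natrD /x; field.
rewrite -mulrBr normrM ger0_norm ?invr_ge0 // -[leRHS]mulrA ler_wpM2l ?invr_ge0 //.
have -> : n%:R * ((n%:R - 1) / 2 - (des s)%:R) = \sum_(k < n) x k.
  rewrite sumrB sum_ord_natr sumr_const card_ord -mulr_natl; by field.
rewrite -exprVn; apply: HC.
  move=> k kn; have kR : k%:R <= n%:R :> R by rewrite ler_nat ltnW.
  have dR : (des s)%:R <= n%:R :> R by rewrite ler_nat.
  have nR : 1 <= n%:R :> R by rewrite ler1n.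
  have k0 : 0 <= k%:R :> R by [].
  have d0 : 0 <= (des s)%:R :> R by [].
  have kR' : k%:R + 1 <= n%:R :> R by rewrite natr1 ler_nat.
  by rewrite ler_norml /x; apply/andP; split; lra.
by rewrite invr_ge0 ler0n invf_le1 ?ltr0n // ler1n.
Qed.

(** * Descents as signs over adjacent positions *)

(** The inner sum has one term, or none at the last position. This form serves both [des] and
    [ndigraphs]. *)
Lemma card_succ (n : nat) (P : rel 'I_n) :
  #|[set i : 'I_n | [exists j : 'I_n, (j == i.+1 :> nat) && P i j]]|
  = (\sum_(i < n) \sum_(j < n | j == i.+1 :> nat) P i j)%N.
Proof.
rewrite -sum1_card big_mkcond; apply: eq_bigr => i _. rewrite inE.
have [lt_in|le_ni] := ltnP i.+1 n; last first.
  rewrite big_pred0 => [|j]; last by apply/negbTE; rewrite neq_ltn (leq_trans (ltn_ord j)).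
  case: existsP => // -[j /andP[/eqP ji _]].
  by move: (ltn_ord j); rewrite ji ltnNge le_ni.
rewrite (big_pred1 (Ordinal lt_in)) => [|j]; last by rewrite /= -val_eqE.
case: existsP => [[j /andP[/eqP ji Pij]]|nP].
  by have -> : Ordinal lt_in = j by [apply: val_inj]; rewrite Pij.
by case Pi: (P i _) => //; case: nP; exists (Ordinal lt_in); rewrite eqxx.
Qed.

Lemma sum_succ1 (R : pzRingType) (n : nat) : (1 <= n)%N ->
  \sum_(i < n) \sum_(j < n | j == i.+1 :> nat) 1 = n%:R - 1 :> R.
Proof.
case: n => // n _; rewrite -natr1 addrK big_ord_recr /= [X in _ + X]big_pred0.
  rewrite addr0 -[n in RHS]card_ord -sum1_card natr_sum; apply: eq_bigr => i _.
  by rewrite (big_pred1 (lift ord0 i)) // => j; rewrite /= -val_eqE.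
by move=> j; apply/negbTE; rewrite neq_ltn ltn_ord.
Qed.

(** The sign of q - p, as a difference of indicators so that its sums are differences of pair
    counts, as in [Z]. *)
Definition order_sign (R : pzRingType) (n : nat) (p q : 'I_n) : R :=
  (p < q)%N%:R - (q < p)%N%:R.

Lemma order_signC (R : pzRingType) (n : nat) (p q : 'I_n) :
  order_sign R p q = - order_sign R q p.
Proof. by rewrite opprB. Qed.

(** Of the n - 1 adjacent pairs, each ascent contributes 1 and each descent 1 - 2. *)
Lemma sum_order_sign_des (R : pzRingType) (n : nat) (s : 'S_n) : (1 <= n)%N ->
  \sum_(i < n) \sum_(j < n | j == i.+1 :> nat) order_sign R (s i) (s j)
  = n%:R - 1 - 2 * (des s)%:R.
Proof.
move=> n1; rewrite -sum_succ1 // /des card_succ natr_sum mulr_sumr -sumrB.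
apply: eq_bigr => i _; rewrite natr_sum mulr_sumr -sumrB.
apply: eq_bigr => j /eqP ji; rewrite /order_sign.
have : s i != s j.
  by rewrite (inj_eq perm_inj); apply/eqP => ij; move: ji; rewrite ij; lia.
rewrite -val_eqE neq_ltn => /orP[] lt_s; rewrite lt_s ltnNge (ltnW lt_s) /=.
  by rewrite mulr0.
by rewrite mulr1 opprD addrA subrr.
Qed.

(** * The action on decks and the permutations carrying D to D' *)

Lemma deck_actM (n : nat) (V : finType) (s t : 'S_n) (D : deck n V) :
  deck_act (s * t)%g D = deck_act t (deck_act s D).
Proof. by apply/ffunP => i; rewrite !ffunE invMg permM. Qed.

Lemma deck_act_inj (n : nat) (V : finType) (t : 'S_n) :
  injective (fun D : deck n V => deck_act t D).
Proof.
by move=> D E DE; apply/ffunP => i; rewrite -(deck_actE t D) DE deck_actE.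
Qed.

Lemma deck_act_tperm (n : nat) (V : finType) (p q : 'I_n) (D : deck n V) :
  D p = D q -> deck_act (tperm p q) D = D.
Proof. by move=> Dpq; apply/ffunP => i; rewrite ffunE tpermV; case: tpermP => // ->. Qed.

Lemma ncards_reordering (n : nat) (V : finType) (D D' : deck n V) (v : V) :
  D' \in reorderings D -> ncards D' v = ncards D v.
Proof.
case/imsetP => t _ ->; rewrite /ncards -[RHS](card_imset _ (@perm_inj _ t)).
apply: eq_card => i; rewrite !inE; apply/idP/imsetP => [Di|[k + ->]].
  by exists ((t^-1)%g i); rewrite ?permKV // inE -(deck_actE t) permKV.
by rewrite inE deck_actE.
Qed.

(** Orbit-stabilizer: right translation by t maps the stabilizer of D onto the permutations carrying
    D to tD, so all fibres of s |-> sD over the orbit have equal size. *)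
Lemma card_transport (n : nat) (V : finType) (D D' : deck n V) :
  D' \in reorderings D ->
  (#|[set s : 'S_n | deck_act s D == D']| * #|reorderings D| = n`!)%N.
Proof.
have E_stab (E : deck n V) : E \in reorderings D ->
    #|[set s : 'S_n | deck_act s D == E]| = #|[set s : 'S_n | deck_act s D == D]|.
  case/imsetP => t _ ->; rewrite -!sum1dep_card (reindex_inj (mulIg t)) /=.
  by apply: eq_bigl => s; rewrite deck_actM (inj_eq (@deck_act_inj n V t)).
move=> /E_stab ->; rewrite -card_Sn -[RHS]sum1_card.
rewrite (partition_big (fun s => deck_act s D) (mem (reorderings D))) /=; last first.
  by move=> s _; apply: imset_f.
rewrite (eq_bigr (fun=> #|[set s : 'S_n | deck_act s D == D]|)).
  by rewrite sum_nat_const mulnC.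
by move=> E /E_stab <-; rewrite -sum1dep_card.
Qed.

Lemma npairsE (n : nat) (V : finType) (D : deck n V) (u v : V) :
  npairs D u v = (\sum_(p | D p == u) \sum_(q | D q == v) (p < q))%N.
Proof.
rewrite /npairs -sum1_card pair_big big_mkcond [RHS]big_mkcond.
by apply: eq_bigr => -[p q] _; rewrite inE /=; case: ltnP; case: (D p == u); case: (D q == v).
Qed.

Lemma Z_order_sign (R : pzRingType) (n : nat) (V : finType) (D : deck n V) (u v : V) :
  (Z D u v)%:~R = \sum_(p | D p == u) \sum_(q | D q == v) order_sign R p q.
Proof.
rewrite /Z rmorphB /= !npairsE [X in _ - (Posz X)%:~R]exchange_big /=.
rewrite -!pmulrn !natr_sum -sumrB; apply: eq_bigr => p _.
by rewrite !natr_sum -sumrB.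
Qed.

(** * Averaging signs over the permutations carrying D to D' *)

(** Applying the transposition of i and j first fixes D and swaps s i with s j, so the sum equals
    its own negative. *)
Lemma sum_order_sign_same (R : numDomainType) (n : nat) (V : finType)
    (D D' : deck n V) (i j : 'I_n) : D i = D j ->
  \sum_(s : 'S_n | deck_act s D == D') order_sign R (s i) (s j) = 0.
Proof.
move=> Dij; set S := LHS; suff : S = - S.
  by move/eqP; rewrite -addr_eq0 -mulr2n mulrn_eq0 => /eqP.
rewrite {1}/S (reindex_inj (mulgI (tperm i j))) /= -sumrN.
apply: eq_big => [s|s _]; first by rewrite deck_actM deck_act_tperm.
by rewrite !permM tpermL tpermR -order_signC.
Qed.

(* If D' = s D has value D i at p and D j at q, then s can be modified by two
   transpositions preserving D' so that it sends i, j to p, q; exchanging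
   (p, q) with (s i, s j) in this way is an involution. *)
Definition exchange_images (n : nat) (i j : 'I_n) (x : 'S_n * ('I_n * 'I_n)) :
    'S_n * ('I_n * 'I_n) :=
  (x.1 * tperm (x.1 i) x.2.1 * tperm (x.1 j) x.2.2, (x.1 i, x.1 j))%g.

Definition deck_transport (n : nat) (V : finType) (D D' : deck n V) (i j : 'I_n)
    (x : 'S_n * ('I_n * 'I_n)) : bool :=
  (deck_act x.1 D == D') && ((D' x.2.1 == D i) && (D' x.2.2 == D j)).

(** In D' the positions s i, p show D i and s j, q show D j. These values differ, so the two
    transpositions have disjoint supports and commute, and a second exchange undoes the first. *)
Lemma exchange_images_spec (n : nat) (V : finType) (D D' : deck n V) (i j : 'I_n)
    (x : 'S_n * ('I_n * 'I_n)) : D i != D j -> deck_transport D D' i j x ->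
  [/\ deck_transport D D' i j (exchange_images i j x),
      exchange_images i j (exchange_images i j x) = x,
      (exchange_images i j x).1 i = x.2.1 & (exchange_images i j x).1 j = x.2.2].
Proof.
case: x => s [p q] Dij /andP[/= /eqP sD /andP[/eqP D'p /eqP D'q]].
have D'si : D' (s i) = D i by rewrite -sD deck_actE.
have D'sj : D' (s j) = D j by rewrite -sD deck_actE.
have neq (k l : 'I_n) : D' k = D i -> D' l = D j -> (k == l) = false.
  by move=> Dk Dl; apply/eqP => kl; case/eqP: Dij; rewrite -Dk -Dl kl.
have neq' (k l : 'I_n) : D' k = D j -> D' l = D i -> (k == l) = false.
  by move=> Dk Dl; rewrite eq_sym neq.
have s'i : (s * tperm (s i) p * tperm (s j) q)%g i = p.
  by rewrite !permM tpermL tpermD // ?neq' // ?neq.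
have s'j : (s * tperm (s i) p * tperm (s j) q)%g j = q.
  by rewrite !permM (@tpermD _ (s i)) ?neq // tpermL.
have comm : (tperm (s j) q * tperm (s i) p = tperm (s i) p * tperm (s j) q)%g.
  rewrite conjgC; congr (_ * _)%g.
  by rewrite tpermJ !tpermD // neq.
split=> //.
- have act_p : deck_act (tperm (s i) p) D' = D'.
    by rewrite deck_act_tperm // D'si D'p.
  have act_q : deck_act (tperm (s j) q) D' = D'.
    by rewrite deck_act_tperm // D'sj D'q.
  by rewrite /deck_transport /= !deck_actM sD act_p act_q D'si D'sj !eqxx.
- rewrite /exchange_images /= s'i s'j (tpermC p) (tpermC q).
  congr (_, _); rewrite -2!mulgA (mulgA (tperm (s j) q)) comm.
  by rewrite !mulgA -!(mulgA _ (tperm _ _) (tperm _ _)) !tperm2 !mulg1.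
Qed.

(** If D i = D j both sides vanish. Otherwise n_u n_v counts the pairs (p, q), and on triples (s, p,
    q) the exchange involution trades the sign of (s i, s j) for that of (p, q), whose sum is free
    of s. *)
Lemma sum_order_sign_transport (R : numDomainType) (n : nat) (V : finType)
    (D D' : deck n V) (i j : 'I_n) : D' \in reorderings D ->
  (ncards D (D i))%:R * (ncards D (D j))%:R *
    \sum_(s : 'S_n | deck_act s D == D') order_sign R (s i) (s j)
  = #|[set s : 'S_n | deck_act s D == D']|%:R * (Z D' (D i) (D j))%:~R.
Proof.
move=> DD'; have [Dij|Dij] := eqVneq (D i) (D j).
  by rewrite sum_order_sign_same // Dij /Z subrr !mulr0.
have pairE (F : 'S_n -> 'I_n -> 'I_n -> R) :
    \sum_(s : 'S_n | deck_act s D == D') \sum_(p | D' p == D i)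
      \sum_(q | D' q == D j) F s p q
    = \sum_(x | deck_transport D D' i j x) F x.1 x.2.1 x.2.2.
  rewrite -(pair_big (fun s => deck_act s D == D')
    (fun y : 'I_n * 'I_n => (D' y.1 == D i) && (D' y.2 == D j))
    (fun s y => F s y.1 y.2)) /=.
  by apply: eq_bigr => s _; rewrite pair_big.
transitivity (\sum_(s : 'S_n | deck_act s D == D') \sum_(p | D' p == D i)
    \sum_(q | D' q == D j) order_sign R (s i) (s j)).
  rewrite mulr_sumr; apply: eq_bigr => s _; rewrite !sumr_const -mulrnA.
  rewrite -!(ncards_reordering _ DD') -natrM mulr_natl mulnC.
  by rewrite /ncards !cardsE.
transitivity (\sum_(s : 'S_n | deck_act s D == D') \sum_(p | D' p == D i)
    \sum_(q | D' q == D j) order_sign R p q); last first.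
  by rewrite -Z_order_sign sumr_const mulr_natl cardsE.
rewrite (pairE (fun s _ _ => order_sign R (s i) (s j))).
rewrite (pairE (fun _ p q => order_sign R p q)).
rewrite (reindex_onto (exchange_images i j) (exchange_images i j)) /=; last first.
  by move=> x /(exchange_images_spec Dij)[].
apply: eq_big => x.
  apply/andP/idP => [[Px /eqP <-]|Px].
    by have [] := exchange_images_spec Dij Px.
  by have [-> ->] := exchange_images_spec Dij Px.
case/andP=> Px /eqP hhx.
have {}Px : deck_transport D D' i j x.
  by rewrite -hhx; have [] := exchange_images_spec Dij Px.
by have [_ _ /= -> ->] := exchange_images_spec Dij Px.
Qed.

(** * The coefficient c_1 as an average over permutations *)

Lemma sum_W_antisym (R : numDomainType) (n : nat) (d : Order.disp_t)
    (V : finOrderType d) (D : deck n V) (F : V -> V -> R) :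
  (forall u v, F u v = - F v u) ->
  \sum_(u in codom D) \sum_(v in codom D | (u < v)%O) (W D u v)%:~R * F u v
  = \sum_(i < n) \sum_(j < n | j == i.+1 :> nat) F (D i) (D j).
Proof.
move=> FC; have F0 u : F u u = 0.
  by have /eqP := FC u u; rewrite -addr_eq0 -mulr2n mulrn_eq0 => /eqP.
pose A u v : R := (ndigraphs D u v)%:R * F u v.
(* By antisymmetry the v-u digraphs subtracted in [W] become the terms [A v u], and the diagonal
   vanishes: the sum over u < v unfolds to all ordered pairs. *)
transitivity (\sum_(u in codom D) \sum_(v in codom D) A u v).
  rewrite [RHS](eq_bigr (fun u =>
      \sum_(v in codom D) (if (u < v)%O then A u v else 0) +
      \sum_(v in codom D) (if (v < u)%O then A u v else 0))); last first.
    move=> u _; rewrite -big_split; apply: eq_bigr => v _ /=.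
    by case: ltgtP => [||->]; rewrite ?addr0 ?add0r // /A F0 mulr0.
  rewrite big_split /= [X in _ + X]exchange_big /= -big_split /=.
  apply: eq_bigr => u _; rewrite -big_split big_mkcondr /=.
  apply: eq_bigr => v _; case: ifP => _; last by rewrite addr0.
  by rewrite /A /W rmorphB /= -!pmulrn [F v u]FC mulrN mulrBl.
rewrite (eq_bigr (fun u => \sum_(i < n) \sum_(j < n | j == i.+1 :> nat)
    \sum_(v in codom D) ((D i == u) && (D j == v))%:R * F u v)); last first.
  move=> u _; rewrite [RHS](eq_bigr (fun i : 'I_n => \sum_(v in codom D)
      \sum_(j < n | j == i.+1 :> nat) ((D i == u) && (D j == v))%:R * F u v)).
    rewrite exchange_big /=; apply: eq_bigr => v _; rewrite /A /ndigraphs.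
    rewrite (card_succ (fun i j : 'I_n => (D i == u) && (D j == v))).
    rewrite natr_sum mulr_suml; apply: eq_bigr => i _.
    by rewrite natr_sum mulr_suml.
  by move=> i _; rewrite exchange_big.
rewrite exchange_big /=; apply: eq_bigr => i _.
rewrite exchange_big /=; apply: eq_bigr => j _.
(* For fixed positions i, j only u = D i, v = D j survives. *)
rewrite (bigD1 (D i)) ?codom_f //= (bigD1 (D j)) ?codom_f //= !eqxx mul1r.
rewrite !big1 ?addr0 // => [u /andP[_ /negbTE Diu]|v /andP[_ /negbTE Djv]].
  by rewrite big1 // => v _; rewrite eq_sym Diu mul0r.
by rewrite eq_sym Djv mul0r.
Qed.

Lemma c1E (R : realType) (n : nat) (d : Order.disp_t) (V : finOrderType d)
    (D D' : deck n V) :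
  c1 R D D' = n%:R / (2 * #|reorderings D|%:R) *
    \sum_(i < n) \sum_(j < n | j == i.+1 :> nat)
      (Z D' (D i) (D j))%:~R / ((ncards D (D i))%:R * (ncards D (D j))%:R).
Proof.
rewrite /c1 -(sum_W_antisym D (F := fun u v =>
  (Z D' u v)%:~R / ((ncards D u)%:R * (ncards D v)%:R))); last first.
  by move=> u v; rewrite -mulNr -rmorphN opprB mulrC (mulrC (ncards D u)%:R) mulrC.
congr (_ * _); apply: eq_bigr => u _; apply: eq_bigr => v _.
by rewrite mulrA.
Qed.

Lemma ncards_neq0 (R : numDomainType) (n : nat) (V : finType) (D : deck n V) (i : 'I_n) :
  (ncards D (D i))%:R != 0 :> R.
Proof. by rewrite pnatr_eq0 -lt0n; apply/card_gt0P; exists i; rewrite inE. Qed.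

Lemma natr_card_transport (R : numFieldType) (n : nat) (V : finType) (D D' : deck n V) :
  D' \in reorderings D ->
  #|[set s : 'S_n | deck_act s D == D']|%:R = n`!%:R / #|reorderings D|%:R :> R.
Proof.
move=> DD'; rewrite -(card_transport DD') natrM mulfK // pnatr_eq0 -lt0n.
by apply/card_gt0P; exists D'.
Qed.

Lemma sumr_transport_const (R : numFieldType) (n : nat) (V : finType)
    (D D' : deck n V) (x : R) : D' \in reorderings D ->
  \sum_(s : 'S_n | deck_act s D == D') x = n`!%:R / #|reorderings D|%:R * x.
Proof.
move=> DD'; rewrite -(natr_card_transport R DD') -sum1dep_card natr_sum mulr_suml.
by apply: eq_bigr => s _; rewrite mul1r.
Qed.

Lemma sum_des_transport (R : realType) (n : nat) (d : Order.disp_t)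
    (V : finOrderType d) (D D' : deck n V) :
  (1 <= n)%N -> D' \in reorderings D ->
  \sum_(s : 'S_n | deck_act s D == D')
    n`!%:R^-1 * (n%:R * ((n%:R - 1) / 2 - (des s)%:R)) = c1 R D D'.
Proof.
(* [K] is the factor left when the coefficient of 1/a is written as a multiple of n - 1 - 2 des
   s. *)
move=> n1 DD'; pose K : R := n%:R / (2 * n`!%:R).
have f_neq0 : n`!%:R != 0 :> R by rewrite pnatr_eq0 -lt0n fact_gt0.
rewrite (eq_bigr (fun s : 'S_n => K * \sum_(i < n) \sum_(j < n | j == i.+1 :> nat)
    order_sign R (s i) (s j))); last first.
  by move=> s _; rewrite sum_order_sign_des // /K; field.
rewrite -mulr_sumr exchange_big c1E /=.
(* n!/N is the number of permutations carrying D to D', the factor that turns averages into sums. *)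
have -> : n%:R / (2 * #|reorderings D|%:R) = K * (n`!%:R / #|reorderings D|%:R) :> R.
  rewrite /K invfM [in RHS]invfM; set N := #|_|%:R^-1.
  by field.
rewrite -[RHS]mulrA; congr (K * _); rewrite mulr_sumr; apply: eq_bigr => i _.
rewrite exchange_big /= mulr_sumr; apply: eq_bigr => j _.
rewrite mulrA -(natr_card_transport R DD') -sum_order_sign_transport //.
by rewrite [RHS]mulrAC mulfV ?mul1r // mulf_neq0 ?ncards_neq0.
Qed.

(** * Expansion of the transition probabilities and of the distance *)

Lemma trans_prob_expand (R : realType) (n : nat) (d : Order.disp_t)
    (V : finOrderType d) (D : deck n V) : (1 <= n)%N ->
  exists C : R, forall D' (a : nat), D' \in reorderings D -> (0 < a)%N ->
    `|trans_prob R a D D' - #|reorderings D|%:R^-1 - c1 R D D' / a%:R|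
      <= C * a%:R ^- 2.
Proof.
move=> n1; have [C HC] := shuffle_prob_expand R n1.
(* Each of the n!/N permutations carrying D to D' has error at most C a^-2, whatever D' is. *)
exists (n`!%:R / #|reorderings D|%:R * C) => D' a DD' a0.
rewrite -sum_des_transport // mulr_suml -[leRHS]mulrA -(sumr_transport_const _ DD').
have f_neq0 : n`!%:R != 0 :> R by rewrite pnatr_eq0 -lt0n fact_gt0.
have -> : #|reorderings D|%:R^-1
    = \sum_(s : 'S_n | deck_act s D == D') n`!%:R^-1 :> R.
  by rewrite sumr_transport_const // mulrAC mulfV ?mul1r.
rewrite /trans_prob -!sumrB; apply: le_trans (ler_norm_sum _ _ _) _.
apply: ler_sum => s _; apply: le_trans (HC s a a0).
by rewrite (mulrDr _ 1) mulr1 opprD addrA !mulrA.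
Qed.

Lemma dist_unif_expand (R : realType) (n : nat) (d : Order.disp_t)
    (V : finOrderType d) (D : deck n V) : (1 <= n)%N ->
  exists C : R, forall a : nat, (0 < a)%N ->
    `|dist_unif R a D - kappa1 R D / a%:R| <= C * a%:R ^- 2.
Proof.
move=> n1; have [C HC] := trans_prob_expand R D n1.
exists (2^-1 * (#|reorderings D|%:R * C)) => a a0.
rewrite /dist_unif /kappa1 -!mulrA -mulrBr normrM ger0_norm ?invr_ge0 //.
rewrite ler_wpM2l ?invr_ge0 // mulr_suml -sumrB.
apply: le_trans (ler_norm_sum _ _ _) _.
rewrite mulr_natl -[leRHS]sumr_const; apply: ler_sum => D' DD'.
apply: le_trans (HC D' a DD' a0).
(* As 1/a >= 0 it moves inside the absolute value, and the reverse triangle inequality applies. *)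
rewrite -[X in _ - _ * X]ger0_norm ?invr_ge0 // -normrM.
exact: ler_dist_dist.
Qed.

Local Open Scope classical_set_scope.

Theorem mainTheorem4 (R : realType) (d : Order.disp_t) (V : finOrderType d)
    (n : nat) (hn : (1 <= n)%N) (D : deck n V) :
  (fun a : nat => dist_unif R a D)
    = (fun a : nat => kappa1 R D * a%:R^-1)
        +O_\oo (fun a : nat => a%:R ^- 2 : R).
Proof.
have [C HC] := dist_unif_expand R D hn.
(* The big-O constant must be positive, while the sign of [C] is unknown. *)
apply/eqaddOP/bigO_exP; exists (`|C| + 1); first by rewrite ltr_wpDl.
exists 1%N => // a /= a0; apply: le_trans (HC a a0) _.
rewrite [leRHS](_ : _ = (`|C| + 1) * a%:R ^- 2).
  by rewrite ler_wpM2r ?invr_ge0 ?exprn_ge0 // ler_wpDr ?ler_norm.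
by congr (_ * _); rewrite ger0_norm ?invr_ge0 ?exprn_ge0.
Qed.
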